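(* A finite group $G$ is induced regular if and only if $G\cong H\times A$, where $A$ is an abelian group and $H$ is an induced regular $p$-group for some prime $p$.
   Context: For a finite group $G$, $C_G(x)$ denotes the centralizer of $x\in G$ and $Z(G)$ the center. The non-centralizer graph $\Upsilon_G$ is the simple graph with vertex set $G$ in which two distinct vertices $x,y$ are adjacent iff $C_G(x)\neq C_G(y)$; the induced non-centralizer graph $\Upsilon_{G\setminus Z(G)}$ is its induced subgraph on $G\setminus Z(G)$. $G$ is called induced regular if $\Upsilon_{G\setminus Z(G)}$ is a regular graph (all vertices have the same degree). *)

(* Defs.v *)
From mathcomp Require Import all_boot all_fingroup all_solvable.
Set Implicit Arguments. Unset Strict Implicit. Unset Printing Implicit Defensive.
Local Open Scope group_scope.

(* The induced non-centralizer graph of a (sub)group G viewed as a group in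
   its own right: vertex set G \ Z(G); distinct x, y adjacent iff
   C_G(x) <> C_G(y).  Degree of x in that graph: *)
Definition nc_degree (gT : finGroupType) (G : {group gT}) (x : gT) : nat :=
  #|[set y in G :\: 'Z(G) | (y != x) && ('C_G[y] != 'C_G[x])]|.

Definition induced_regular (gT : finGroupType) (G : {group gT}) : Prop :=
  forall x y, x \in G :\: 'Z(G) -> y \in G :\: 'Z(G) ->
    nc_degree G x = nc_degree G y.

(* Main.v *)
Require Import Defs.
From mathcomp Require Import all_boot all_fingroup all_solvable.
From mathcomp Require Import zify.
Set Implicit Arguments. Unset Strict Implicit. Unset Printing Implicit Defensive.
Local Open Scope group_scope.

(** Write Z = Z(G).  Regularity says that the classes
    [{y | C_G(y) = C_G(x)}], x noncentral, all have the same size b.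
    If C_G(y) is maximal among centralizers of noncentral elements, its centre
    E_y is the union of Z and the class of y, so [|E_y| = b + |Z|].  For a
    noncentral q-element u with [C_G(u) <= C_G(y)], if E_y had no noncentral
    q-element then u E_y would lie in the class of u and be too large; so every
    prime divisor of [|G : Z|] divides the common value n of [|E_y : Z|].

    Suppose n has two prime divisors.  Counting products of elements of coprime
    orders shows that every centralizer lies in a unique maximal one, and then
    that the maximal ones are abelian.  Hence all noncentral centralizers M are
    abelian, with [|M : Z| = n] and [|G : M| = s].  The number of classes is
    [(s n - 1) / (n - 1)], so n - 1 divides s - 1 and [n <= s].  On the other
    hand a Sylow p-subgroup P normalizes some M, and P / (P :&: M) acts
    semiregularly on the noncentral elements of the Sylow q-subgroup of M for
    q != p, whence [s_p < n_q].  Multiplying over a cyclic arrangement of the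
    primes gives [s < n], a contradiction.

    So G / Z is a p-group, and [G = O_p(G) x O_p'(G)] with O_p'(G) central. *)

(** * Centralizers and the classes of elements that share one *)

Definition cent_class (gT : finGroupType) (G : {group gT}) (x : gT) : {set gT} :=
  [set y in G | 'C_G[y] == 'C_G[x]].

Section CentClass.

Variables (gT : finGroupType) (G : {group gT}).
Implicit Types (x y z u v g : gT) (pi : nat_pred).

Lemma subcent1_center x : x \in 'Z(G) -> 'C_G[x] = G.
Proof.
case/centerP=> Gx cGx; apply/setIidPl/subsetP=> y Gy.
by apply/cent1P/commute_sym; apply: cGx.
Qed.

Lemma mem_center_subcent1 x : x \in G -> (x \in 'Z(G)) = (G \subset 'C_G[x]).
Proof.
move=> Gx; apply/idP/idP=> [/subcent1_center-> // | /subsetP sG].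
by apply/centerP; split=> // y /sG /subcent1P[].
Qed.

Lemma cent_class_noncentral x : x \in G :\: 'Z(G) -> cent_class G x \subset G :\: 'Z(G).
Proof.
case/setDP=> Gx nZx; apply/subsetP=> y; rewrite inE => /andP[Gy /eqP eC].
by rewrite inE Gy andbT mem_center_subcent1 // eC -mem_center_subcent1.
Qed.

Lemma nc_degree_cent_class x : x \in G :\: 'Z(G) ->
  nc_degree G x + #|cent_class G x| = #|G :\: 'Z(G)|.
Proof.
move=> nZx; rewrite -(cardsID (cent_class G x) (G :\: 'Z(G))) addnC.
rewrite (setIidPr (cent_class_noncentral nZx)); congr (_ + _)%N.
apply: eq_card => y; rewrite !inE; case: (y \in G); rewrite ?andbF //= !andbT.
by rewrite andbC; case: eqVneq => [->|]; rewrite ?eqxx.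
Qed.

Lemma induced_regularP :
  induced_regular G <->
  {in G :\: 'Z(G) &, forall x y, #|cent_class G x| = #|cent_class G y|}.
Proof.
by split=> reg x y nZx nZy; move: (reg x y nZx nZy);
   move: (nc_degree_cent_class nZx) (nc_degree_cent_class nZy); lia.
Qed.

Lemma mem_center_subcent1E x y : x \in G ->
  (y \in 'Z('C_G[x])) = (y \in G) && ('C_G[x] \subset 'C_G[y]).
Proof.
move=> Gx; apply/centerP/andP=> [[/setIP[Gy _] cy] | [Gy /subsetP sC]].
  by split=> //; apply/subsetP=> z Cz; rewrite inE (subsetP (subcent1_sub x G)) //;
     apply/cent1P/commute_sym; apply: cy.
split; first by apply: subcent1C => //; apply: sC; apply: subcent1_id.
by move=> z /sC/subcent1P[].
Qed.

Lemma subcent1M_sub x y : 'C_G[x] :&: 'C_G[y] \subset 'C_G[x * y].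
Proof.
apply/subsetP=> z /setIP[/subcent1P[Gz cx] /subcent1P[_ cy]].
apply/subcent1P; split=> //; apply/commute_sym.
by apply: commuteM; apply/commute_sym.
Qed.


Lemma subcent1_constt x pi : 'C_G[x] \subset 'C_G[x.`_pi].
Proof.
apply/setIS/subsetP=> z /cent1P cz; apply/cent1P.
by have /cycleP[i ->] := cycle_constt pi x; apply: commuteX.
Qed.

(** Both factors are constituents, hence powers, of [x * y], so whatever centralizes the product
    centralizes each of them. *)
Lemma subcent1M_coprime pi x y :
    pi.-elt x -> pi^'.-elt y -> commute x y ->
  'C_G[x * y] = 'C_G[x] :&: 'C_G[y].
Proof.
move=> pix piy cxy; apply/eqP; rewrite eqEsubset subcent1M_sub andbT.
have ex : (x * y).`_pi = x by rewrite consttM // (constt_p_elt pix) (constt1P piy) mulg1.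
have ey : (x * y).`_pi^' = y.
  by rewrite consttM // (constt_p_elt piy) (constt1P _) ?mul1g // /p_elt pnatNK.
by rewrite subsetI; apply/andP; split; [rewrite -{2}ex | rewrite -{2}ey]; apply: subcent1_constt.
Qed.

Lemma subcent1_mulZ x z : z \in 'Z(G) -> 'C_G[x * z] = 'C_G[x].
Proof.
have sub y t : t \in 'Z(G) -> 'C_G[y] \subset 'C_G[y * t].
  move=> Zt; apply: subset_trans (subcent1M_sub _ _).
  by rewrite (subcent1_center Zt) subsetI subxx subcent1_sub.
by move=> Zz; apply/eqP; rewrite eqEsubset sub // -{2}(mulgK z x) sub ?groupV.
Qed.

(** Everything in ['C_G[x]] commutes with [g], so inside this subgroup the factor [g] imposes no
    condition. *)
Lemma subcent1_capMr x u g :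
  g \in 'Z('C_G[x]) -> 'C_G[u * g] :&: 'C_G[x] = 'C_G[u] :&: 'C_G[x].
Proof.
move=> Zg.
have sub a h : h \in 'Z('C_G[x]) -> 'C_G[a] :&: 'C_G[x] \subset 'C_G[a * h].
  case/centerP=> _ ch; apply: subset_trans (subcent1M_sub _ _).
  rewrite setIS //; apply/subsetP=> z Cz; rewrite inE (subsetP (subcent1_sub x G)) //.
  by apply/cent1P/commute_sym; apply: ch.
apply/eqP; rewrite eqEsubset; apply/andP; split; last by rewrite subsetI sub // subsetIr.
by rewrite subsetI subsetIr andbT -{2}(mulgK g u) sub ?groupV.
Qed.

End CentClass.

Lemma p_elt_outsideP (gT : finGroupType) (Z E : {group gT}) (p : nat) :
    prime p -> Z <| E ->
  reflect (exists2 u, u \in E :\: Z & p.-elt u) (p %| #|E : Z|).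
Proof.
move=> pr_p /andP[sZE nZE]; apply: (iffP idP) => [pE | [u /setDP[Eu nZu] pu]].
  have [S sylS] := Sylow_exists p E; have [sSE pS] := (pHall_sub sylS, pHall_pgroup sylS).
  have [sSZ | /subsetPn[u Su nZu]] := boolP (S \subset Z); last first.
    by exists u; rewrite ?inE ?nZu ?(subsetP sSE) ?(mem_p_elt pS).
  case/and3P: sylS => _ _; rewrite -(Lagrange_index sZE sSZ) pnatM p'natE //.
  by rewrite pE.
apply: contraR nZu => pE; have Nu := subsetP nZE u Eu.
apply: coset_idr => //; rewrite -(constt_p_elt (morph_p_elt (coset_morphism Z) Nu pu)).
apply/constt1P; apply: mem_p_elt (mem_quotient Z Eu).
by rewrite /pgroup card_quotient // p'natE.
Qed.

(** * Maximal centralizers when all noncentral classes have size [b] *)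

Section EqualClasses.

Variables (gT : finGroupType) (G : {group gT}) (b : nat).
Hypothesis card_class : forall x, x \in G :\: 'Z(G) -> #|cent_class G x| = b.
Implicit Types (x y z u v g : gT) (pi : nat_pred).

Local Notation E x := ('Z('C_G[x])).

Definition max_cent y :=
  y \in G :\: 'Z(G) /\
  forall w, w \in G :\: 'Z(G) -> 'C_G[y] \subset 'C_G[w] -> 'C_G[w] = 'C_G[y].

Lemma exists_max_cent x : x \in G :\: 'Z(G) ->
  exists2 y, max_cent y & 'C_G[x] \subset 'C_G[y].
Proof.
move=> Gx; pose P y := (y \in G :\: 'Z(G)) && ('C_G[x] \subset 'C_G[y]).
have Px : P x by rewrite /P Gx /=.
case: (arg_maxnP (fun y => #|'C_G[y]|) Px) => y /andP[Gy sxy] ymax.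
exists y => //; split=> // w Gw syw; apply/eqP; rewrite eq_sym eqEcard syw.
by apply: ymax; rewrite /P Gw (subset_trans sxy).
Qed.

Lemma subcent1_of_max y g : max_cent y -> g \in E y -> g \notin 'Z(G) -> 'C_G[g] = 'C_G[y].
Proof.
case=> /setDP[Gy _] ymax; rewrite mem_center_subcent1E // => /andP[Gg syg] nZg.
by apply: ymax => //; rewrite inE nZg.
Qed.

Lemma center_sub_centers x : x \in G -> 'Z(G) \subset E x.
Proof.
move=> Gx; apply/subsetP=> z Zz; rewrite mem_center_subcent1E //.
by rewrite (subcent1_center Zz) subcent1_sub (subsetP (center_sub G)).
Qed.

Lemma centers_sub x : E x \subset G.
Proof. exact: subset_trans (center_sub _) (subcent1_sub _ _). Qed.

Lemma card_max_cent y : max_cent y -> #|E y| = (b + #|'Z(G)|)%N.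
Proof.
move=> My; have [nZy _] := My; have [Gy _] := setDP nZy.
rewrite -(card_class nZy) addnC -(cardsID 'Z(G) (E y)).
rewrite (setIidPr (center_sub_centers Gy)); congr (_ + _)%N.
apply: eq_card => g; rewrite [RHS]inE inE.
apply/andP/andP=> [[nZg Eg] | [Gg /eqP eC]].
  by rewrite (subcent1_of_max My) // eqxx (subsetP (centers_sub y)).
rewrite mem_center_subcent1E // Gg -eC subxx; split=> //.
have: g \in cent_class G y by rewrite inE Gg eC /=.
by move/(subsetP (cent_class_noncentral nZy)); case/setDP.
Qed.

(** The coset of [E y] has [b + #|'Z(G)|] elements, too many for the class of [u]. Used by case
    analysis, it leaves constancy of the centralizer on the coset as the goal. *)
Lemma class_coset_absurd u y : u \in G :\: 'Z(G) -> max_cent y ->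
  (forall g, g \in E y -> 'C_G[u * g] = 'C_G[u]) -> False.
Proof.
move=> nZu My eC; have [Gu _] := setDP nZu.
suff: #|u *: E y| <= #|cent_class G u|.
  rewrite card_lcoset card_max_cent // card_class // -{2}[b]addn0 leq_add2l.
  by rewrite leqNgt cardG_gt0.
apply/subset_leq_card/subsetP=> _ /lcosetP[g Eg ->].
by rewrite inE eC // eqxx andbT groupM // (subsetP (centers_sub y)).
Qed.

Lemma max_cent_commute y u g : u \in 'C_G[y] -> g \in E y -> commute u g.
Proof. by move=> Cu /centerP[_ cg]; apply/commute_sym/cg. Qed.

Lemma center_normal_centers x : x \in G -> 'Z(G) <| E x.
Proof.
move=> Gx; rewrite /normal center_sub_centers //.
exact: subset_trans (centers_sub x) (normal_norm (center_normal G)).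
Qed.

Lemma subcent1M_split pi y u g : u \in 'C_G[y] -> g \in E y -> pi.-elt u ->
  'C_G[u * g] = 'C_G[u * g.`_pi] :&: 'C_G[g.`_pi^'].
Proof.
move=> Cu Eg piu; rewrite -{1}(consttC pi g) mulgA.
have cg rho : commute u g.`_rho by apply: (max_cent_commute Cu); apply: groupX.
apply: (@subcent1M_coprime _ G pi); rewrite ?p_elt_constt //.
  by apply: p_eltM; rewrite ?p_elt_constt.
by apply/commute_sym/commuteM; apply/commute_sym => //; apply: commuteX2.
Qed.

Lemma prime_index_max_cent q y0 : prime q -> max_cent y0 ->
  q %| #|G : 'Z(G)| -> q %| #|E y0 : 'Z(G)|.
Proof.
move=> pr_q My0 /(p_elt_outsideP pr_q (center_normal G))[u nZu qu].
have [y My suy] := exists_max_cent nZu; have [Gu _] := setDP nZu.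
have [[/setDP[Gy0 _] _] [/setDP[Gy _] _]] := (My0, My).
(* All maximal centralizers have centres of the same order, so [y0] may be replaced by a [y] lying
   above [u]. *)
have -> : #|E y0 : 'Z(G)| = #|E y : 'Z(G)|.
  by rewrite -!divgS ?center_sub_centers // !card_max_cent.
apply: contraT => nqE; case: (class_coset_absurd nZu My) => g Eg.
have Cu : u \in 'C_G[y] by rewrite (subsetP suy) ?subcent1_id.
have Egc pi : g.`_pi \in E y by apply: groupX.
have Zgq : g.`_q \in 'Z(G).
  apply: contraR nqE => nZg; apply/(p_elt_outsideP pr_q (center_normal_centers Gy)).
  by exists g.`_q; rewrite ?p_elt_constt //; apply/setDP.
rewrite (subcent1M_split Cu Eg qu) (subcent1_mulZ _ Zgq); apply/setIidPl.
by have:= Egc q^'; rewrite mem_center_subcent1E // => /andP[_]; apply: subset_trans.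
Qed.

(** The noncentral [pi^']-part of [g] contributes exactly ['C_G[y]]; within that subgroup the
    [pi]-part of [g] has no effect. *)
Lemma subcent1M_cross pi y u g : max_cent y -> u \in 'C_G[y] -> g \in E y ->
  pi.-elt u -> g.`_pi^' \notin 'Z(G) -> 'C_G[u * g] = 'C_G[u] :&: 'C_G[y].
Proof.
move=> My Cu Eg piu nZg.
have Egc : g.`_pi^' \in E y by apply: groupX.
rewrite (subcent1M_split Cu Eg piu) (subcent1_of_max My Egc nZg).
by rewrite subcent1_capMr ?groupX.
Qed.

(** * Two primes dividing the index of the centre force abelian centralizers *)

(** Two prime divisors of the common index of ['Z(G)] in [E y] provide this, with [pi] one of them.
    Being symmetric in [pi] and [pi^'], it lets each lemma be applied to both sets. *)
Definition mixed_centers pi := forall y, max_cent y ->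
  (exists2 e, e \in E y :\: 'Z(G) & pi.-elt e) /\
  (exists2 e, e \in E y :\: 'Z(G) & pi^'.-elt e).

(* If the two centralizers differed, the class of C_G(y1) :&: C_G(y2) would contain
   e2 * g for g in E y1 with noncentral pi-part and f2 * g for g in E y1 with
   noncentral pi'-part, where e2 and f2 are noncentral elements of E y2 with
   pi'- and pi-order respectively; that is more than b elements. *)
Lemma max_cent_unique pi x y1 y2 : mixed_centers pi -> x \in G ->
    max_cent y1 -> max_cent y2 ->
    'C_G[x] \subset 'C_G[y1] -> 'C_G[x] \subset 'C_G[y2] ->
  'C_G[y1] = 'C_G[y2].
Proof.
move=> mix Gx M1 M2 s1 s2; apply/eqP; apply: contraT => neq12.
have [[/setDP[Gy1 nZy1] _] [/setDP[Gy2 _] _]] := (M1, M2).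
have sE2 g : g \in E y2 -> g \in 'C_G[y1].
  rewrite mem_center_subcent1E // => /andP[Gg sg].
  apply: (subsetP s1); apply: (subsetP (center_sub _)).
  by rewrite mem_center_subcent1E // Gg (subset_trans s2).
have tiE g : g \in E y1 -> g \in E y2 -> g \in 'Z(G).
  move=> E1g E2g; apply: contraR neq12 => nZg.
  by rewrite -(subcent1_of_max M1 E1g) // -(subcent1_of_max M2 E2g).
have [[e1 /setDP[E1e1 nZe1] pe1] [f1 /setDP[E1f1 nZf1] pf1]] := mix _ M1.
have [[f2 /setDP[E2f2 nZf2] pf2] [e2 /setDP[E2e2 nZe2] pe2]] := mix _ M2.
pose X1 := [set g in E y1 | g.`_pi \notin 'Z(G)].
pose X2 := [set g in E y1 | g.`_pi^' \notin 'Z(G)].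
have eC1 g : g \in X1 -> 'C_G[e2 * g] = 'C_G[y2] :&: 'C_G[y1].
  rewrite inE => /andP[E1g nZg]; rewrite (subcent1M_cross M1 (sE2 _ E2e2) E1g pe2) ?consttNK //.
  by rewrite (subcent1_of_max M2 E2e2).
have eC2 g : g \in X2 -> 'C_G[f2 * g] = 'C_G[y2] :&: 'C_G[y1].
  rewrite inE => /andP[E1g nZg]; rewrite (subcent1M_cross M1 (sE2 _ E2f2) E1g pf2) //.
  by rewrite (subcent1_of_max M2 E2f2).
have X1e1 : e1 \in X1 by rewrite inE E1e1 constt_p_elt.
have [sG1 sG2] := (subsetP (centers_sub y1), subsetP (centers_sub y2)).
pose w := e2 * e1; have Cw : 'C_G[w] = 'C_G[y2] :&: 'C_G[y1] by apply: eC1.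
have nZw : w \in G :\: 'Z(G).
  have Gw : w \in G by apply: groupM; [apply: sG2 | apply: sG1].
  rewrite inE Gw andbT mem_center_subcent1 // Cw; apply: contra nZy1 => sG.
  by rewrite mem_center_subcent1 // (subset_trans sG) ?subsetIr.
(* An element with both parts central is central, so the union is all of [E y1] outside ['Z(G)]. *)
have cardE : #|X1 :|: X2| = b.
  apply/eqP; rewrite -(eqn_add2r #|'Z(G)|) -(card_max_cent M1) -(cardsID 'Z(G) (E y1)).
  rewrite (setIidPr (center_sub_centers Gy1)) addnC eqn_add2l; apply/eqP/eq_card => g.
  apply/setUP/setDP=> [[] /setIdP[E1g nZg] | [E1g nZg]]; try split=> //.
  - by apply: contra nZg; apply: groupX.
  - by apply: contra nZg; apply: groupX.
  have [Zp | nZp] := boolP (g.`_pi \in 'Z(G)); [right | left]; apply/setIdP; split=> //.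
  by apply: contra nZg => Zq; rewrite -(consttC pi g) groupM.
(* The overlap makes [#|X1| + #|X2|] strictly larger than [b]. *)
have X12 : 0 < #|X1 :&: X2|.
  have cef : commute e1 f1 by apply: (max_cent_commute _ E1f1); rewrite (subsetP (center_sub _)).
  rewrite card_gt0; apply/set0Pn; exists (e1 * f1).
  apply/setIP; split; apply/setIdP; (split; first exact: groupM); rewrite consttM //.
    by rewrite (constt_p_elt pe1) (constt1P pf1) mulg1.
  by rewrite (constt_p_elt pf1) (constt1P _) ?p_eltNK // mul1g.
(* A common element would put [f2^-1 * e2] in both centres, hence in ['Z(G)], and with it its
   [pi^']-part [e2]. *)
have tiX : [disjoint e2 *: X1 & f2 *: X2].
  rewrite -setI_eq0; apply: contraT => /set0Pn[_ /setIP[/lcosetP[g Xg ->] /lcosetP[h Xh]]].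
  case/setIdP: Xg Xh => E1g _ /setIdP[E1h _] eq_gh.
  have eZ : f2^-1 * e2 = h * g^-1 by rewrite -(mulgK g e2) eq_gh !mulgA mulVg mul1g.
  have Zef : f2^-1 * e2 \in 'Z(G).
    by apply: tiE; [rewrite eZ|]; rewrite groupM ?groupV.
  have cef : commute f2^-1 e2.
    by apply: (max_cent_commute _ E2e2); rewrite groupV (subsetP (center_sub _)).
  case/negP: nZe2; rewrite -(constt_p_elt pe2).
  have : (f2^-1 * e2).`_pi^' \in 'Z(G) by apply: groupX.
  by rewrite consttM // consttV (constt1P _) ?p_eltNK // invg1 mul1g.
have: #|e2 *: X1 :|: f2 *: X2| <= #|cent_class G w|.
  apply/subset_leq_card/subsetP=> _ /setUP[] /lcosetP[g Xg ->].
    by rewrite inE Cw eC1 // eqxx andbT groupM ?(sG2 e2) ?sG1 //; case/setIdP: Xg.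
  by rewrite inE Cw eC2 // eqxx andbT groupM ?(sG2 f2) ?sG1 //; case/setIdP: Xg.
rewrite card_class // cardsU disjoint_setI0 // cards0 subn0 !card_lcoset -cardsUI cardE.
by rewrite -{2}[b]addn0 leq_add2l leqNgt X12.
Qed.

(** For a [pi]-element [u] of ['C_G[y]] outside [E y], uniqueness of the maximal centralizer gives
    ['C_G[u] \subset 'C_G[y]]. Multiplying [u] by elements of [E y] then preserves its centralizer,
    against [class_coset_absurd]. *)
Lemma mixed_pi_elt_mem pi y u : mixed_centers pi -> max_cent y ->
  u \in 'C_G[y] -> pi.-elt u -> u \in E y.
Proof.
move=> mix My Cu piu; apply: contraT => nEu.
have [nZy _] := My; have [Gy _] := setDP nZy.
have nZ t : t \in G -> t \notin E y -> t \in G :\: 'Z(G).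
  move=> Gt nEt; apply/setDP; split=> //; apply: contra nEt.
  exact: subsetP (center_sub_centers Gy) t.
have GC t : t \in 'C_G[y] -> t \in G by apply: subsetP; apply: subcent1_sub.
have [_ [v /setDP[Ev nZv] pi'v]] := mix y My.
have sC t : t \in 'C_G[y] -> pi.-elt t -> t \notin E y -> 'C_G[t] \subset 'C_G[y].
  move=> Ct pit nEt; have Gt := GC t Ct.
  have [y' My' sty'] := exists_max_cent (nZ t Gt nEt).
  have eC : 'C_G[t * v] = 'C_G[t] :&: 'C_G[y].
    by apply: (subcent1M_cross My Ct Ev pit); rewrite (constt_p_elt pi'v).
  (* Both maximal centralizers contain ['C_G[t * v]], so [max_cent_unique] applies. *)
  suff -> : 'C_G[y] = 'C_G[y'] by [].
  apply: (@max_cent_unique pi (t * v)) => //; rewrite ?eC ?subsetIr //.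
    by rewrite groupM ?(subsetP (centers_sub y) v).
  exact: subset_trans (subsetIl _ _) sty'.
case: (class_coset_absurd (nZ u (GC u Cu) nEu) My) => g Eg.
have Egc rho : g.`_rho \in E y by apply: groupX.
have Cug : u * g.`_pi \in 'C_G[y] by rewrite groupM // (subsetP (center_sub _)).
have sCug : 'C_G[u * g.`_pi] \subset 'C_G[y].
  apply: sC => //; last by rewrite groupMr.
  by apply: p_eltM; rewrite ?p_elt_constt //; apply: (max_cent_commute Cu).
(* The [pi^']-part of [g] is absorbed since its centralizer contains ['C_G[y]]; the [pi]-part is
   then removed by [subcent1_capMr]. *)
rewrite (subcent1M_split Cu Eg piu).
have:= Egc pi^'; rewrite mem_center_subcent1E // => /andP[_ sg].
rewrite (setIidPl (subset_trans sCug sg)) -(setIidPl sCug) subcent1_capMr //.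
by apply/setIidPl; apply: sC.
Qed.

(** Splitting elements into [pi]- and [pi^']-parts shows that a maximal centralizer equals its own
    centre. Any noncentral [x] below it lies in that centre, so its centralizer is already the
    maximal one. *)
Lemma mixed_subcent1 pi x : mixed_centers pi -> x \in G :\: 'Z(G) ->
  'C_G[x] = E x /\ max_cent x.
Proof.
move=> mix nZx; have [y My sxy] := exists_max_cent nZx; have [Gx _] := setDP nZx.
have [[/setDP[Gy _] ymax]] := My.
have mix' : mixed_centers pi^'.
  move=> z /mix[[e Ee pe] [f Ef pf]]; split; first by exists f.
  by exists e; rewrite ?p_eltNK.
have eCE : 'C_G[y] = E y.
  apply/eqP; rewrite eqEsubset center_sub andbT; apply/subsetP=> u Cu.
  rewrite -(consttC pi u) groupM //.
    by apply: (mixed_pi_elt_mem mix My); rewrite ?p_elt_constt ?groupX.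
  by apply: (mixed_pi_elt_mem mix' My); rewrite ?p_elt_constt ?groupX.
have eC : 'C_G[x] = 'C_G[y].
  apply: subcent1_of_max => //; last by case/setDP: nZx.
  by rewrite -eCE (subsetP sxy) ?subcent1_id.
by rewrite /max_cent eC; split=> //; split=> // w nZw; apply: ymax.
Qed.

End EqualClasses.

(** * Abelian centralizers of equal order: two opposite index inequalities *)

(* Compare the product of the f's with that of the g's rotated by one place. *)
Lemma ltn_prod_off_diag (f g : nat -> nat) (r : seq nat) :
    uniq r -> 1 < size r -> {in r &, forall p q, p != q -> f p < g q} ->
  \prod_(p <- r) f p < \prod_(p <- r) g p.
Proof.
case: r => [|x [|z r]] // Ur _ fg.
have main l y : uniq (y :: l) -> {in y :: l &, forall p q, p != q -> f p < g q} ->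
    \prod_(p <- belast y l) f p <= \prod_(p <- l) g p.
  elim: l y => [|w l IHl] y Uy fgy; first by rewrite !big_nil.
  rewrite /= !big_cons leq_mul //.
    apply/ltnW/fgy; rewrite ?inE ?eqxx ?orbT //.
    by move: Uy => /= /andP[]; rewrite inE negb_or => /andP[].
  apply: IHl; first by case/andP: Uy.
  by move=> p q lp lq; apply: fgy; rewrite inE ?lp ?lq orbT.
have lastx : last x (z :: r) != x.
  case/andP: Ur => nx _; apply: contraNneq nx => {1}<-; exact: mem_last.
have fglast : f (last x (z :: r)) < g x.
  by apply: fg => //; [exact: mem_last | exact: mem_head].
have /main/(_ fg) le := Ur.
have gt0 : 0 < \prod_(p <- z :: r) g p.
  rewrite big_seq_cond; apply: prodn_cond_gt0 => q /andP[rq _].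
  apply: leq_ltn_trans (leq0n (f x)) _.
  apply: fg; rewrite ?mem_head // ?[_ \in x :: _]in_cons ?rq ?orbT //.
  by case/andP: Ur => nx _; apply: contraNneq nx => ->.
rewrite [X in X < _](_ : _ = \prod_(p <- belast x (z :: r)) f p * f (last x (z :: r)))%N.
  rewrite [X in _ < X]big_cons mulnC.
  by apply: leq_ltn_trans (leq_mul (leqnn _) le) _; rewrite ltn_pmul2r.
by rewrite [in LHS]lastI -cats1 big_cat /= big_seq1.
Qed.

Lemma subcent1J (gT : finGroupType) (G : {group gT}) (x y : gT) :
  y \in G -> 'C_G[x ^ y] = 'C_G[x] :^ y.
Proof. by move=> Gy; rewrite conjIg conjGid // cent1J. Qed.

Section AbelianCentralizers.

Variables (gT : finGroupType) (G : {group gT}).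
Hypothesis abelC : forall x, x \in G :\: 'Z(G) -> abelian 'C_G[x].
Hypothesis cardC : {in G :\: 'Z(G) &, forall x y, #|'C_G[x]| = #|'C_G[y]|}.

Lemma subcent1_eq x m : x \in G :\: 'Z(G) -> m \in 'C_G[x] -> m \notin 'Z(G) ->
  'C_G[m] = 'C_G[x].
Proof.
move=> nZx Cm nZm; have [Gx _] := setDP nZx; have [Gm _] := setIP Cm.
have nZm' : m \in G :\: 'Z(G) by apply/setDP.
have sub u v : u \in G :\: 'Z(G) -> v \in 'C_G[u] -> 'C_G[u] \subset 'C_G[v].
  move=> nZu Cv; apply/subsetP=> w Cw; apply/subcent1P.
  split; first by case/setIP: Cw.
  by have /centsP := abelC nZu; apply.
by apply/eqP; rewrite eqEsubset !sub // subcent1C.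
Qed.

Lemma center_sub_subcent1 x : x \in G -> 'Z(G) \subset 'C_G[x].
Proof.
by move=> Gx; apply: subset_trans (center_sub_centers Gx) (center_sub _).
Qed.

Lemma part_index_subcent1 p q x : x \in G :\: 'Z(G) -> prime p -> prime q -> p != q ->
    p %| #|'C_G[x] : 'Z(G)| -> q %| #|'C_G[x] : 'Z(G)| ->
  #|G : 'C_G[x]|`_p < #|'C_G[x] : 'Z(G)|`_q.
Proof.
move=> nZx pr_p pr_q neq_pq pn qn; have [Gx _] := setDP nZx.
have nZG := normal_norm (center_normal G).
have [P sylP] := Sylow_exists p G; have [sPG pP] := (pHall_sub sylP, pHall_pgroup sylP).
have nZP := subset_trans sPG nZG.
have ntP : P / 'Z(G) != 1.
  rewrite -cardG_gt1 (card_Hall (quotient_pHall nZP sylP)) card_quotient //.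
  rewrite p_part_gt1 mem_primes pr_p indexg_gt0 /=.
  rewrite -(Lagrange_index (subcent1_sub x G) (center_sub_subcent1 Gx)).
  by rewrite dvdn_mull.
have ntZ : 'Z(P / 'Z(G)) != 1.
  apply: contraNneq ntP => /(trivg_center_pgroup (quotient_pgroup _ pP)) e1.
  by rewrite e1.
(* Lift a nontrivial central element of [P / 'Z(G)]: commutators of [z] with [P] are central, so [P]
   normalizes ['C_G[z]]. Equal orders then allow [z] to replace [x]. *)
have [zb /centerP[/morphimP[z Nz Pz ->] cz] ntz] := trivgPn _ ntZ.
have Gz := subsetP sPG z Pz.
have nZz : z \in G :\: 'Z(G).
  by apply/setDP; split=> //; apply: contra ntz => Zz; apply/eqP/coset_id.
have nCP : P \subset 'N('C_G[z]).
  apply/subsetP=> y Py; have Ny := subsetP nZP y Py; have Gy := subsetP sPG y Py.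
  have Zzy : [~ z, y] \in 'Z(G).
    apply: coset_idr; first by rewrite groupR.
    by rewrite morphR //; apply/eqP/commgP/cz; apply: mem_quotient.
  by rewrite inE -subcent1J // conjg_mulR subcent1_mulZ.
have eqcard : #|'C_G[x]| = #|'C_G[z]| by apply: cardC.
have -> : #|G : 'C_G[x]| = #|G : 'C_G[z]| by rewrite -!divgS ?subcent1_sub ?eqcard.
have eqn : #|'C_G[x] : 'Z(G)| = #|'C_G[z] : 'Z(G)|.
  by rewrite -!divgS ?center_sub_subcent1 ?eqcard.
move: qn; rewrite eqn {eqn pn eqcard} => qn.
pose M := 'C_G[z]%G; change (is_true (q %| #|M : 'Z(G)|)) in qn.
change (is_true (#|G : M|`_p < #|M : 'Z(G)|`_q)).
have sMG : M \subset G := subcent1_sub z G.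
have sZM : 'Z(G) \subset M := center_sub_subcent1 Gz.
have abM : abelian M := abelC nZz.
pose Q := 'O_q(M)%G.
have hallQ : q.-Sylow(M) Q := nilpotent_pcore_Hall q (abelian_nil abM).
have sQM := pHall_sub hallQ.
have nQP : P \subset 'N(Q) := char_norm_trans (pcore_char q M) nCP.
pose X := Q :\: 'Z(G); pose d := #|P : P :&: M|.
have actX : [acts P, on X | 'J] by rewrite astabsJ normsD.
(* Each [m] in [X] has centralizer [M], so its stabilizer is [P :&: M] and every orbit has length
   [d]. *)
have cardX : d %| #|X|.
  rewrite (@card_uniform_partition _ d _ X _ (orbit_partition actX)) ?dvdn_mull //.
  move=> _ /imsetP[m /setDP[Qm nZm] ->]; rewrite card_orbit astab1J.
  have eC : 'C_G[m] = M by apply: subcent1_eq => //; apply: (subsetP sQM).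
  by rewrite -(setIidPl sPG) -setIA eC (setIidPl sPG).
have hallQZ : q.-Sylow('Z(G)) (Q :&: 'Z(G)) := setI_normal_Hall (pcore_normal q M) hallQ sZM.
have Xeq : #|X| = (#|'Z(G)|`_q * (#|M : 'Z(G)|`_q).-1)%N.
  rewrite cardsD (card_Hall hallQZ) (card_Hall hallQ) -(Lagrange sZM).
  by rewrite partnM ?indexg_gt0 ?cardG_gt0 // -subn1 mulnBr muln1.
have pd : p.-nat d by apply: pnat_dvd (dvdn_indexg _ _) pP.
have dn : d %| (#|M : 'Z(G)|`_q).-1.
  rewrite -(@Gauss_dvdr _ #|'Z(G)|`_q) -?Xeq //.
  apply: (pnat_coprime pd); apply: sub_in_pnat (part_pnat _ _) => r _ /eqP->.
  by rewrite !inE eq_sym.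
have n_gt1 : 1 < #|M : 'Z(G)|`_q by rewrite p_part_gt1 mem_primes pr_q indexg_gt0.
have le_d : d < #|M : 'Z(G)|`_q.
  by rewrite -(ltn_predK n_gt1) ltnS dvdn_leq // -subn1 subn_gt0.
apply: leq_ltn_trans le_d.
have le_PM : #|P :&: M| <= #|M|`_p.
  rewrite -(part_pnat_id (pgroupS (subsetIl P M) pP)).
  by rewrite dvdn_leq ?part_gt0 // partn_dvd // cardSg ?subsetIr.
(* Both sides equal [#|P|]; as [#|P :&: M|] is at most the [p]-part of [#|M|], the [p]-part of
   [#|G : M|] is at most [d]. *)
have cardP : (#|M|`_p * #|G : M|`_p = #|P :&: M| * d)%N.
  rewrite Lagrange ?subsetIl // (card_Hall sylP) -(Lagrange sMG).
  by rewrite partnM ?cardG_gt0 ?indexg_gt0.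
by rewrite -(leq_pmul2l (part_gt0 p #|M|)) cardP leq_mul2r le_PM orbT.
Qed.

Lemma index_subcent1_ltn p q x : x \in G :\: 'Z(G) -> prime p -> prime q -> p != q ->
    p %| #|'C_G[x] : 'Z(G)| -> q %| #|'C_G[x] : 'Z(G)| ->
    (forall r, prime r -> r %| #|G : 'Z(G)| -> r %| #|'C_G[x] : 'Z(G)|) ->
  #|G : 'C_G[x]| < #|'C_G[x] : 'Z(G)|.
Proof.
move=> nZx pr_p pr_q neq_pq pn qn primesn; have [Gx _] := setDP nZx.
set s := #|G : _|; set n := #|_ : _|.
have [s_gt0 n_gt0] : 0 < s /\ 0 < n by rewrite !indexg_gt0.
have prodE m : 0 < m -> {subset \pi(m) <= \pi(n)} ->
    m = (\prod_(r <- primes n) m`_r)%N.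
  move=> m_gt0 sub.
  rewrite -{1}(@part_pnat_id \pi(n) m); last exact: sub_in_pnat (fun r _ => sub r) (pnat_pi m_gt0).
  (* The bound [m + n] makes the range contain every prime divisor of [n], even those exceeding
     [m]. *)
  rewrite (@widen_partn (m + n)) ?leq_addr // -big_filter.
  rewrite (perm_big (primes n)); first by apply: eq_bigr => r _; rewrite p_part.
  apply: uniq_perm; rewrite ?filter_uniq ?iota_uniq ?primes_uniq // => r.
  rewrite mem_filter mem_index_iota; apply: andb_idr => rn.
  move: (rn); rewrite mem_primes => /and3P[_ _ /dvdn_leq]; lia.
have subs : {subset \pi(s) <= \pi(n)}.
  move=> r; rewrite !mem_primes => /and3P[pr_r _ rs]; rewrite pr_r n_gt0 /= primesn //.
  rewrite -(Lagrange_index (subcent1_sub x G) (center_sub_subcent1 Gx)).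
  by rewrite dvdn_mulr.
rewrite (prodE s) // [X in _ < X](prodE n) //.
apply: ltn_prod_off_diag; rewrite ?primes_uniq //.
  apply: (@uniq_leq_size _ [:: p; q]); first by rewrite /= inE neq_pq.
  by move=> r; rewrite !inE mem_primes => /orP[] /eqP->; rewrite n_gt0 ?pr_p ?pr_q.
move=> r t; rewrite !mem_primes => /and3P[pr_r _ rn] /and3P[pr_t _ tn] neq_rt.
exact: part_index_subcent1.
Qed.

Lemma leq_index_subcent1 b x : x \in G :\: 'Z(G) ->
    (forall y, y \in G :\: 'Z(G) -> #|cent_class G y| = b) ->
    #|'C_G[x]| = (b + #|'Z(G)|)%N ->
  #|'C_G[x] : 'Z(G)| <= #|G : 'C_G[x]|.
Proof.
move=> nZx card_class cardx; have [Gx nZx'] := setDP nZx.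
have sZC := center_sub_subcent1 Gx; have sCG := subcent1_sub x G.
(* The fibres of the centralizer map on noncentral elements are the classes, all of size [b]. *)
have dvdb : b %| #|G :\: 'Z(G)|.
  have part := preim_partitionP (fun y => 'C_G[y]) (G :\: 'Z(G)).
  rewrite (@card_uniform_partition _ b _ _ _ part) ?dvdn_mull //.
  move=> _ /imsetP[y nZy ->]; rewrite -(card_class y nZy); apply: eq_card => w.
  rewrite [LHS]inE [RHS]inE eq_sym; apply: andb_id2r => /eqP eC.
  have [Gy nZy'] := setDP nZy; apply/setDP/idP=> [[] // | Gw]; split=> //.
  by rewrite mem_center_subcent1 // eC -mem_center_subcent1.
move: dvdb; rewrite cardsD (setIidPr (center_sub G)).
have s_gt1 : 1 < #|G : 'C_G[x]|.
  by rewrite indexg_gt1; apply: contra nZx'; rewrite mem_center_subcent1.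
have := Lagrange sZC; have := Lagrange sCG; rewrite cardx.
have := cardG_gt0 'Z(G); move: s_gt1.
move: #|G| #|'Z(G)| #|_ : _| #|_ : _| => g z n s s_gt1 z_gt0 eg en dvdb.
case: n en => [|n]; first by rewrite muln0; lia.
rewrite mulnS => en; have {}en : b = (z * n)%N by lia.
rewrite -ltnS; case: s s_gt1 eg => [|s] // s_gt0 eg.
suff /dvdn_leq : n %| s by lia.
(* Here [n] and [s] are the two indices minus one and [b = z * n]; the claim becomes that [b]
   divides [z * s]. *)
rewrite -(@dvdn_pmul2l z) // -en; move: dvdb.
have -> : (g - z = s.+1 * b + z * s)%N by rewrite -eg; lia.
by rewrite dvdn_addr // dvdn_mull.
Qed.

End AbelianCentralizers.

(** * The central quotient is a p-group *)

Lemma induced_regular_pgroup (gT : finGroupType) (G : {group gT}) :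
    induced_regular G -> ~~ abelian G ->
  exists2 p : nat, prime p & p.-group (G / 'Z(G)).
Proof.
move=> /induced_regularP reg nabG.
have [x0 nZx0] : exists x0, x0 \in G :\: 'Z(G).
  apply/set0Pn; apply: contra nabG; rewrite setD_eq0 => sGZ.
  exact: abelianS sGZ (center_abelian G).
pose b := #|cent_class G x0|.
have card_class x : x \in G :\: 'Z(G) -> #|cent_class G x| = b by move=> nZx; apply: reg.
have [y0 My0 _] := exists_max_cent nZx0.
have [nZy0 _] := My0; have [Gy0 nZy0'] := setDP nZy0.
have idx y q : prime q -> q %| #|G : 'Z(G)| -> max_cent G y ->
    exists2 e, e \in 'Z('C_G[y]) :\: 'Z(G) & q.-elt e.
  move=> pr_q qG My; have [/setDP[Gy _] _] := My.
  apply/(p_elt_outsideP pr_q (center_normal_centers Gy)).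
  exact: (prime_index_max_cent card_class).
have n_gt1 : 1 < #|G : 'Z(G)|.
  by rewrite indexg_gt1; apply: contra nZy0' => /subsetP; apply.
pose p := pdiv #|G : 'Z(G)|; have pr_p : prime p by apply: pdiv_prime.
exists p => //; rewrite /pgroup card_quotient ?(normal_norm (center_normal G)) //.
apply: contraT => npG.
have [q pr_q [qG neq_qp]] : exists2 q, prime q & q %| #|G : 'Z(G)| /\ q != p.
  move: npG; rewrite /pnat indexg_gt0 /= => /allPn[q].
  by rewrite mem_primes => /and3P[pr_q _ qG] neq_qp; exists q.
have mix : mixed_centers G p.
  move=> y My; split; first by apply: idx; rewrite ?pdiv_dvd.
  have [e Ee qe] := idx y q pr_q qG My; exists e => //.
  by apply: sub_p_elt qe => r /eqP->.
have eqC x : x \in G :\: 'Z(G) -> 'C_G[x] = 'Z('C_G[x]).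
  by move=> nZx; have [] := mixed_subcent1 card_class mix nZx.
have maxC x : x \in G :\: 'Z(G) -> max_cent G x.
  by move=> nZx; have [] := mixed_subcent1 card_class mix nZx.
have cardC x : x \in G :\: 'Z(G) -> #|'C_G[x]| = (b + #|'Z(G)|)%N.
  by move=> nZx; rewrite eqC // (card_max_cent card_class) //; apply: maxC.
have abelC x : x \in G :\: 'Z(G) -> abelian 'C_G[x].
  by move=> nZx; rewrite eqC // center_abelian.
have eq_cardC : {in G :\: 'Z(G) &, forall x y, #|'C_G[x]| = #|'C_G[y]|}.
  by move=> x y nZx nZy; rewrite !cardC.
have dvdC r : prime r -> r %| #|G : 'Z(G)| -> r %| #|'C_G[x0] : 'Z(G)|.
  move=> pr_r rG; rewrite eqC //.
  by apply: (prime_index_max_cent card_class) => //; apply: maxC.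
(* Counting classes and the Sylow argument give opposite inequalities between the indices above and
   below ['C_G[x0]]. *)
have := leq_index_subcent1 nZx0 card_class (cardC _ nZx0).
rewrite leqNgt => /negP[].
by apply: (@index_subcent1_ltn _ _ abelC eq_cardC p q); rewrite 1?eq_sym ?dvdC ?pdiv_dvd.
Qed.

(** * Invariance under isomorphism and under abelian direct factors *)

Lemma injm_cent_class (aT rT : finGroupType) (D G : {group aT})
    (f : {morphism D >-> rT}) (x : aT) :
    'injm f -> G \subset D -> x \in G ->
  cent_class (f @* G) (f x) = f @* cent_class G x.
Proof.
move=> injf sGD Gx; have GD := subsetP sGD.
have eqC y : y \in G -> ('C_(f @* G)[f y] == 'C_(f @* G)[f x]) = ('C_G[y] == 'C_G[x]).
  move=> Gy; rewrite -!injm_subcent1 ?GD //.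
  have sCD z : 'C_G[z] \subset D by apply: subset_trans (subcent1_sub _ _) sGD.
  by apply/eqP/eqP=> [/injm_morphim_inj-> | ->].
apply/setP=> w; rewrite inE; apply/andP/morphimP.
  case=> /morphimP[y Dy Gy ->]; rewrite eqC // => Cy.
  by exists y; rewrite // inE Gy.
by case=> y Dy; rewrite inE => /andP[Gy Cy ->]; rewrite mem_morphim // eqC.
Qed.

Lemma isog_induced_regular (aT rT : finGroupType) (G : {group aT}) (K : {group rT}) :
  G \isog K -> induced_regular G -> induced_regular K.
Proof.
case/isogP=> f injf defK /induced_regularP reg.
have -> : K = (f @* G)%G by apply: val_inj.
apply/induced_regularP.
suff fc x : x \in f @* G :\: 'Z(f @* G) ->
    exists2 y, y \in G :\: 'Z(G) & #|cent_class (f @* G) x| = #|cent_class G y|.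
  by move=> _ _ /fc[x nZx ->] /fc[y nZy ->]; apply: reg.
rewrite -injm_center // => /setDP[/morphimP[y _ Gy ->] nZy].
exists y; last first.
  rewrite injm_cent_class // card_injm //.
  by apply/subsetP=> z; rewrite inE => /andP[].
by apply/setDP; split=> //; apply: contra nZy => Zy; rewrite mem_morphim.
Qed.

Section DirectFactor.

Variables (gT : finGroupType) (G H A : {group gT}).
Hypotheses (defG : H \x A = G) (abA : abelian A).

Lemma dprod_abelian_sub_center : A \subset 'Z(G).
Proof.
have [_ <- cHA _] := dprodP defG.
by rewrite subsetI mulG_subr centM subsetI cHA.
Qed.

Lemma dprod_subcent1 h : h \in H -> 'C_G[h] = 'C_H[h] * A.
Proof.
have [_ <- cHA _] := dprodP defG; move=> Hh; rewrite setIC [in RHS]setIC.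
by rewrite -group_modr // sub_cent1; apply: subsetP Hh; rewrite centsC.
Qed.

Lemma dprod_subcent1_sub h : 'C_H[h] = H :&: 'C_G[h].
Proof.
have [_ <- _ _] := dprodP defG.
by rewrite setIA (setIidPl (mulG_subl A H)).
Qed.

Lemma dprod_noncentral h a : h \in H -> a \in A ->
  (h * a \in G :\: 'Z(G)) = (h \in H :\: 'Z(H)).
Proof.
have [_ eG _ _] := dprodP defG; move=> Hh Aa.
have Za := subsetP dprod_abelian_sub_center a Aa.
have Gha : h * a \in G by rewrite -eG mem_mulg.
suff eqZ : (h * a \in 'Z(G)) = (h \in 'Z(H)).
  by apply/setDP/setDP; rewrite eqZ => -[].
rewrite mem_center_subcent1 // subcent1_mulZ // mem_center_subcent1 //.
apply/idP/idP=> [sG | sH].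
  by rewrite dprod_subcent1_sub subsetI subxx (subset_trans _ sG) // -eG mulG_subl.
by rewrite dprod_subcent1 // -{1}eG mulSg.
Qed.

(** Since [A] is central, the class of [h * a] is the class of [h] in [H] times [A]; trivial
    intersection makes this product unique. Hence adding or removing [A] rescales all class sizes
    uniformly. *)
Lemma dprod_card_cent_class h a : h \in H -> a \in A ->
  #|cent_class G (h * a)| = (#|cent_class H h| * #|A|)%N.
Proof.
have [_ eG _ tiHA] := dprodP defG; move=> Hh Aa.
have ZA := subsetP dprod_abelian_sub_center.
have eqC k c : k \in H -> c \in A ->
    ('C_G[k * c] == 'C_G[h * a]) = ('C_H[k] == 'C_H[h]).
  move=> Hk Ac; rewrite !subcent1_mulZ ?ZA //; apply/eqP/eqP=> eC.
    by rewrite !dprod_subcent1_sub eC.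
  by rewrite !dprod_subcent1 ?eC.
rewrite -cardsX -(@card_in_imset _ _ (fun u => u.1 * u.2)).
  apply: eq_card => w; rewrite [LHS]inE -eG; apply/andP/imsetP.
    case=> /mulsgP[k c Hk Ac ->]; rewrite eG eqC // => eC.
    by exists (k, c); rewrite // in_setX Ac inE Hk eC.
  case=> [[k c]] /setXP[/= ]; rewrite inE => /andP[Hk eC] Ac ->.
  by rewrite mem_mulg // eG eqC.
move=> [k c] [k' c'] /setXP[/= Hk Ac] /setXP[/= Hk' Ac'] eq.
have {}Hk : k \in H by move: Hk; rewrite inE => /andP[].
have {}Hk' : k' \in H by move: Hk'; rewrite inE => /andP[].
have e1 : k'^-1 * k = c' * c^-1 by rewrite -(mulgK c k) eq !mulgA mulVg mul1g.
have: k'^-1 * k \in H :&: A.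
  by rewrite inE {2}e1 !groupM ?groupV.
rewrite tiHA => /set1P e; move: e1; rewrite e => e1.
congr (_, _); first by rewrite -[k](mulKVg k') e mulg1.
by rewrite -[c'](mulgKV c) -e1 mul1g.
Qed.

Lemma dprod_induced_regular : induced_regular G <-> induced_regular H.
Proof.
rewrite !induced_regularP; have [_ eG _ _] := dprodP defG.
split=> reg x y nZx nZy.
  have [[Hx _] [Hy _]] := (setDP nZx, setDP nZy).
  have := reg (x * 1) (y * 1); rewrite !dprod_noncentral // !dprod_card_cent_class //.
  by move/(_ nZx nZy)/eqP; rewrite eqn_pmul2r ?cardG_gt0 // => /eqP.
have [[]] := (setDP nZx, setDP nZy).
rewrite -{1}eG => /mulsgP[h a Hh Aa ex] _ [].
rewrite -{1}eG => /mulsgP[k c Hk Ac ey] _.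
move: nZx nZy; rewrite ex ey !dprod_noncentral // !dprod_card_cent_class // => nZh nZk.
by rewrite (reg h k).
Qed.

End DirectFactor.

Lemma isog_setXl (aT rT : finGroupType) (H : {group aT}) :
  H \isog setX H (1 : {set rT}).
Proof.
by rewrite -morphim_pairg1 sub_isog ?subsetT ?injm_pairg1.
Qed.

Lemma isog_setXr (aT rT : finGroupType) (H : {group aT}) :
  H \isog setX (1 : {set rT}) H.
Proof.
by rewrite -morphim_pair1g sub_isog ?subsetT ?injm_pair1g.
Qed.

(** * The classification *)

Theorem theorem3p9 (gT : finGroupType) (G : {group gT}) :
  induced_regular G <->
  exists (hT aT : finGroupType) (H : {group hT}) (A : {group aT}) (p : nat),
    [/\ prime p, p.-group H, induced_regular H, abelian A
      & G \isog setX H A].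
Proof.
split=> [regG | [hT [aT [H [A [p [_ _ regH abA isoG]]]]]]]; last first.
  apply: isog_induced_regular (isog_symr isoG) _.
  have defX := setX_dprod H A.
  have abX : abelian (setX (1 : {set hT}) A) :=
    etrans (esym (isog_abelian (isog_setXr hT A))) abA.
  apply/(dprod_induced_regular defX abX).
  exact: isog_induced_regular (isog_setXl _ H) regH.
suff [p [H [A [pr_p pH abA defG]]]] : exists p (H A : {group gT}),
    [/\ prime p, p.-group H, abelian A & H \x A = G].
  exists gT, gT, H, A, p; split=> //; first exact/(dprod_induced_regular defG abA).
  exact: isog_dprod defG (setX_dprod H A) (isog_setXl _ H) (isog_setXr _ A).
have [abG | nabG] := boolP (abelian G).
  (* The trivial group is a p-group for every prime, so 2 is an arbitrary choice. *)
  by exists 2, 1%G, G; split; rewrite ?pgroup1 ?dprod1g.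
have [p pr_p pGZ] := induced_regular_pgroup regG nabG.
have nilG : nilpotent G by rewrite -quotient_center_nil (pgroup_nil pGZ).
exists p, 'O_p(G)%G, 'O_p^'(G)%G; split=> //; rewrite ?pcore_pgroup ?nilpotent_pcoreC //.
apply: abelianS (center_abelian G).
rewrite -quotient_sub1; last first.
  exact: subset_trans (pcore_sub _ _) (normal_norm (center_normal G)).
(* The image of the [p^']-core in the p-group [G / 'Z(G)] is a [p^']-group, hence trivial; so this
   core is central and thus abelian. *)
have tiO : coprime #|'O_p^'(G) / 'Z(G)| #|G / 'Z(G)|.
  rewrite coprime_sym; apply: pnat_coprime pGZ _.
  exact: quotient_pgroup (pcore_pgroup _ _).
by rewrite -(coprime_TIg tiO) subsetI subxx quotientS ?pcore_sub.
Qed.
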